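(* Let $p>1$, $0<h\le1$ with $ph>1$, and let $\alpha>0$. Let $\{X_t\}_{t\in[0,T]}$ be a continuous $\{\mathcal F_t\}$-adapted $\mathbb R^d$-valued process which satisfies the conditional increment control with parameter $(p,h)$ and constant $A_{p,h}$, and which has uniform $\alpha$-exponential marginal decay with constants $C_1,C_2>0$. Then there is a constant $C$ depending only on $(C_1,C_2,\alpha,p,h,A_{p,h})$ such that, for all large enough $\lambda$, $$\mathbb P\left(\sup_{t\in[0,T]}|X_t|\ge\lambda\right)\le C\lambda^{-1/h}\exp\left[-\frac{C_1}{2^{\alpha+2}}\left(1-\frac1{ph}\right)\lambda^\alpha\right].$$
   Context: $(\Omega,\{\mathcal F_t\}_{t\ge0},\mathcal F,\mathbb P)$ is a filtered probability space satisfying the usual conditions, and $T>0$ is fixed. Conditional increment control with parameter $(p,h)$ and constant $A_{p,h}\ge0$ means: $X_t\in L^p(\Omega,\mathbb R^d)$ for all $t\in[0,T]$ and $\mathbb E\left[|\mathbb E(X_t\mid\mathcal F_s)-X_s|^p\right]\le A_{p,h}|t-s|^{ph}$ for all $0\le s<t\le T$, where $A_{p,h}$ does not depend on $s,t$. Uniform $\alpha$-exponential marginal decay with constants $C_1,C_2>0$ means: $\mathbb P(|X_t|\ge\lambda)\le C_2\exp(-C_1\lambda^\alpha)$ for all $\lambda>0$ and all $t\in[0,T]$. ''For all large enough $\lambda$'' means that there is a threshold $\lambda_0>0$ such that the bound holds for all $\lambda\ge\lambda_0$. *)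

(* Defs.v *)
From HB Require Import structures.
From mathcomp Require Export all_boot all_order all_algebra.
From mathcomp Require Export all_classical all_reals all_analysis.
Export Order.TTheory GRing.Theory Num.Theory.
Export numFieldNormedType.Exports.

Set Implicit Arguments.
Unset Strict Implicit.
Unset Printing Implicit Defensive.

Local Open Scope classical_set_scope.
Local Open Scope ring_scope.

(* Euclidean norm on R^d; the library norm `|v| on 'rV[R]_d is the sup norm. *)
Definition enorm {R : realType} {d : nat} (v : 'rV[R]_d) : R :=
  Num.sqrt (\sum_(i < d) v 0 i ^+ 2).

Section filtrations.
Context {disp : measure_display} {Omega : measurableType disp} {R : realType}.
Implicit Types (P : probability Omega R) (F : R -> set (set Omega)).

(* Only the values F t with 0 <= t are meaningful. *)
Definition filtration F : Prop :=
  (forall t : R, 0 <= t -> sigma_algebra [set: Omega] (F t)) /\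
  (forall t : R, 0 <= t -> F t `<=` measurable) /\
  (forall s t : R, 0 <= s -> s <= t -> F s `<=` F t).

Definition usual_conditions P F : Prop :=
  measure_is_complete P /\
  P.-negligible `<=` F 0 /\
  (forall t : R, 0 <= t -> \bigcap_(u in [set u | t < u]) F u = F t).

End filtrations.

Section conditional_expectation.
Context {disp : measure_display} {Omega : measurableType disp} {R : realType}.
Implicit Types (P : probability Omega R) (G : set (set Omega)).

Definition measurable_wrt G (X : Omega -> R) : Prop :=
  forall B : set R, measurable B -> G (X @^-1` B).

Definition vmeasurable_wrt G (d : nat) (X : Omega -> 'rV[R]_d) : Prop :=
  forall i : 'I_d, measurable_wrt G (fun w => X w 0 i).

(* Y is a version of E(X | G). *)
Definition is_condexp P G (X Y : Omega -> R) : Prop :=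
  P.-integrable setT (EFin \o X) /\
  P.-integrable setT (EFin \o Y) /\
  measurable_wrt G Y /\
  (forall A, G A ->
    (\int[P]_(w in A) (Y w)%:E = \int[P]_(w in A) (X w)%:E)%E).

Definition is_vcondexp P G (d : nat) (X Y : Omega -> 'rV[R]_d) : Prop :=
  forall i : 'I_d, is_condexp P G (fun w => X w 0 i) (fun w => Y w 0 i).

End conditional_expectation.

Section processes.
Context {disp : measure_display} {Omega : measurableType disp} {R : realType}.
Context {d : nat}.
Implicit Types (P : probability Omega R) (F : R -> set (set Omega)).
Implicit Types (T : R) (X : R -> Omega -> 'rV[R]_d).

Definition adapted F T X : Prop :=
  forall t : R, 0 <= t <= T -> vmeasurable_wrt (F t) (X t).

Definition continuous_process P T X : Prop :=
  {ae P, forall w, {within `[0, T], continuous (fun t => X t w)}}.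

(* E(X_t | F_s) is unique up to P-almost sure equality, so the value of the
   expectation does not depend on the version Y. *)
Definition conditional_increment_control P F T X (p h A : R) : Prop :=
  (forall t : R, 0 <= t <= T -> (fun w => enorm (X t w)) \in Lfun P p%:E) /\
  (forall s t : R, 0 <= s -> s < t -> t <= T ->
    exists Y : Omega -> 'rV[R]_d,
      is_vcondexp P (F s) (X t) Y /\
      ('E_P[fun w => (enorm (Y w - X s w) `^ p)%R]
         <= (A * `|t - s| `^ (p * h))%:E)%E).

Definition exp_marginal_decay P T X (alpha C1 C2 : R) : Prop :=
  forall t lambda : R, 0 <= t <= T -> 0 < lambda ->
    (P [set w | (lambda <= enorm (X t w))%R]
       <= (C2 * expR (- (C1 * lambda `^ alpha)))%:E)%E.

(* Taken in the extended reals: it is +oo on unbounded paths, which can occur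
   on the null set of discontinuous paths. *)
Definition sup_enorm T X (w : Omega) : \bar R :=
  ereal_sup [set (enorm (X t w))%:E | t in `[0, T]].

End processes.

(* Main.v *)
From mathcomp Require Import ring lra measurable_realfun.
Require Import Defs.

Set Implicit Arguments.
Unset Strict Implicit.
Unset Printing Implicit Defensive.

Local Open Scope classical_set_scope.
Local Open Scope ring_scope.

(** Why the theorem holds.

    Fix a step delta = T / N and refine the grid of multiples of delta
    dyadically.  At refinement level n let g_i, i <= N 2^n, be vector fields,
    g_i measurable at the time t_i = i delta / 2^n, with |g_0| + |g_1| + ... at
    most 1.  The quantity sum_i E <g_i, X(t_i)> can be bounded by moving every
    odd grid time to its right neighbour.  Since g_i is known at time t_i, this
    replaces the increment of X by its conditional expectation, and only the
    controlled quantity |E(X_t | F_s) - X_s| enters.  Splitting that quantity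
    at a threshold e_k costs e_k per unit of mass plus e_k^(1-p) times its p-th
    moment.  At level k there are N 2^k moves, each with moment at most
    A (delta / 2^(k+1))^(ph).  As ph > 1, thresholds e_k that decay
    geometrically make both the sum of the thresholds and the sum of the moment
    terms converge (step_error_geometric).  After n moves only the N + 1
    unrefined grid times are left, and there the marginal tails apply.  This is
    the lemma chaining.

    Choose now g_i = X(t_i) / |X(t_i)| on the event that t_i is the first grid
    time with |X| >= ell, and 0 elsewhere.  Then sum_i E <g_i, X(t_i)> is at
    least ell P(max |X(t_i)| >= ell), while the mass of the g_i is at most that
    same probability.  The result is a maximal inequality on the grid, uniform
    in n (grid_maximal), which by path continuity passes to the supremum over [0, T]
    (sup_event_le).  Stopping at the first hit plays the role of Doob's
    inequality, and conditional expectations occur only through their defining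
    integral identity, extended from indicators to bounded weights
    (Rintegral_bounded_mul0).

    With ell = 3 lambda / 4, marginal tails at level lambda / 2 and thresholds
    of total size lambda / 8, the probability is at most a constant times

      N exp(- 2 a lambda^alpha) + T^(ph) N^(1 - ph),    a = C1 / 2^(alpha + 2).

    For N of order exp(a lambda^alpha) both terms decay strictly faster than
    exp(- a (1 - 1/(ph)) lambda^alpha), because 1/(ph) > 0 and
    ph - 1 > 1 - 1/(ph).  The surplus in the exponent absorbs the factor
    lambda^(1/h), the horizon T and every constant once lambda is large, which
    is why the value C = 1 is possible. *)

(** * Euclidean norm and inner product *)

Section euclidean.
Context {R : realType} {d : nat}.
Implicit Types u v : 'rV[R]_d.

Definition dotv u v : R := \sum_(i < d) u 0 i * v 0 i.

Lemma enorm_ge0 u : 0 <= enorm u.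
Proof. exact: sqrtr_ge0. Qed.

Lemma enorm_sqr u : enorm u ^+ 2 = dotv u u.
Proof. by rewrite sqr_sqrtr ?sumr_ge0// => i _; exact: sqr_ge0. Qed.

Lemma coord_le_enorm u i : `|u 0 i| <= enorm u.
Proof.
rewrite -sqrtr_sqr ler_wsqrtr// (bigD1 i)//= lerDl.
by apply: sumr_ge0 => j _; exact: sqr_ge0.
Qed.

Lemma enorm_eq0 u : enorm u = 0 -> u = 0.
Proof.
move=> u0; apply/rowP => i; rewrite mxE; apply/eqP.
by have := coord_le_enorm u i; rewrite u0 normr_le0.
Qed.

Lemma enormZ (a : R) u : 0 <= a -> enorm (a *: u) = a * enorm u.
Proof.
move=> a0; rewrite /enorm.
under eq_bigr do rewrite mxE exprMn.
by rewrite -mulr_sumr sqrtrM ?sqr_ge0// sqrtr_sqr ger0_norm.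
Qed.

Lemma dotvZl (a : R) u v : dotv (a *: u) v = a * dotv u v.
Proof. by rewrite /dotv mulr_sumr; apply: eq_bigr => i _; rewrite mxE mulrA. Qed.

Lemma dotvDl u u' v : dotv (u + u') v = dotv u v + dotv u' v.
Proof. by rewrite /dotv -big_split; apply: eq_bigr => i _; rewrite mxE mulrDl. Qed.

Lemma dotvBr u v v' : dotv u (v - v') = dotv u v - dotv u v'.
Proof. by rewrite /dotv -sumrB; apply: eq_bigr => i _; rewrite !mxE mulrBr. Qed.

Lemma dotv_le_enorm u v : dotv u v <= enorm u * enorm v.
Proof.
have [u0|u0] := eqVneq (enorm u) 0.
  rewrite u0 mul0r (enorm_eq0 u0) /dotv big1// => i _.
  by rewrite mxE mul0r.
have [v0|v0] := eqVneq (enorm v) 0.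
  rewrite v0 mulr0 (enorm_eq0 v0) /dotv big1// => i _.
  by rewrite mxE mulr0.
have up : 0 < enorm u by rewrite lt_def u0 enorm_ge0.
have vp : 0 < enorm v by rewrite lt_def v0 enorm_ge0.
rewrite -(@ler_pM2l _ (2 * enorm u * enorm v)) ?mulr_gt0//.
(* Expand 0 <= | |v| u - |u| v |^2. *)
have : 0 <= \sum_(i < d) (enorm v * u 0 i - enorm u * v 0 i) ^+ 2.
  by apply: sumr_ge0 => i _; exact: sqr_ge0.
rewrite (_ : \sum_(i < d) _ = enorm v ^+ 2 * dotv u u + enorm u ^+ 2 * dotv v v
   - 2 * enorm u * enorm v * dotv u v); last first.
  rewrite /dotv !mulr_sumr -big_split/= -sumrB; apply: eq_bigr => i _; ring.
rewrite -!enorm_sqr; lra.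
Qed.

Lemma ler_enormD u v : enorm (u + v) <= enorm u + enorm v.
Proof.
rewrite -(@ler_pXn2r _ 2) ?nnegrE ?addr_ge0 ?enorm_ge0//.
rewrite enorm_sqr (_ : dotv (u + v) (u + v) = dotv u u + dotv v v + 2 * dotv u v).
  by rewrite -!enorm_sqr; have := dotv_le_enorm u v; nra.
rewrite /dotv mulr_sumr -!big_split/=; apply: eq_bigr => i _; rewrite !mxE; ring.
Qed.

(** The length is at most 1 rather than equal to 1 because 0 is sent to 0. *)
Lemma enorm_unit u : enorm ((enorm u)^-1 *: u) <= 1.
Proof.
rewrite enormZ ?invr_ge0 ?enorm_ge0//.
have [->|u0] := eqVneq (enorm u) 0; first by rewrite mulr0.
by rewrite mulVf.
Qed.

Lemma dotv_unit u : dotv ((enorm u)^-1 *: u) u = enorm u.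
Proof.
rewrite dotvZl -enorm_sqr.
have [->|u0] := eqVneq (enorm u) 0; first by rewrite expr0n mulr0.
by rewrite expr2 mulKf.
Qed.

Lemma continuous_enorm : continuous (@enorm R d).
Proof.
move=> u; apply: (@continuous_comp _ _ _ (fun u : 'rV[R]_d => \sum_(i < d) u 0 i ^+ 2)
   (@Num.sqrt R)); last exact: sqrt_continuous.
apply: continuous_big; first exact: add_continuous.
move=> i _ {}u.
apply: (@continuous_comp _ _ _ (fun v : 'rV[R]_d => v 0 i) (fun x => x ^+ 2)).
  exact: coord_continuous.
exact: exprn_continuous.
Qed.

End euclidean.

Section measurability.
Context {R : realType}.

Lemma measurable_enorm d (T : measurableType d) n (X : T -> 'rV[R]_n) :
  (forall i, measurable_fun setT (fun w => X w 0 i)) ->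
  measurable_fun setT (fun w => enorm (X w)).
Proof.
move=> mX; apply: (@measurableT_comp _ _ _ _ _ _ (@Num.sqrt R)).
  by apply: continuous_measurable_fun; exact: sqrt_continuous.
by apply: measurable_sum => i; exact: measurable_funX.
Qed.

(** Turns a sigma-algebra given as a set of sets into a measurable type of its
    own, so that the calculus of measurable functions applies to it. *)
Lemma measurable_wrtP d (T : measurableType d) (G : set (set T)) (X : T -> R) :
  sigma_algebra setT G ->
  measurable_wrt G X <-> measurable_fun [set: g_sigma_algebraType G] X.
Proof.
move=> sG; split => mX.
- move=> _ B mB; rewrite setTI /measurable/=.
  by apply: sub_sigma_algebra; exact: mX.
- move=> B mB; have := mX measurableT B mB; rewrite setTI.
  by rewrite /measurable/= sigma_algebra_id.
Qed.

Lemma measurable_wrt_fun d (T : measurableType d) (G : set (set T)) (X : T -> R) :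
  G `<=` measurable -> measurable_wrt G X -> measurable_fun setT X.
Proof. by move=> GT mX _ B mB; rewrite setTI; apply: GT; exact: mX. Qed.

End measurability.

(** * Real-valued expectations and bounded weights *)

Section real_integration.
Context {disp : measure_display} {T : measurableType disp} {R : realType}.
Variable P : probability T R.
Implicit Types (f g Z : T -> R) (G : set (set T)).

Local Notation integrable f := (P.-integrable setT (EFin \o f)).

Lemma integrable_measurable f : integrable f -> measurable_fun setT f.
Proof. by move=> /measurable_int /measurable_EFinP. Qed.

Lemma integrable_dominated f g : measurable_fun setT f ->
  (forall w, `|f w| <= g w) -> integrable g -> integrable f.
Proof.
move=> mf fg ig; apply: (le_integrable measurableT) ig.
- exact/measurable_EFinP.
- by move=> w _ /=; rewrite lee_fin (le_trans (fg w))// ler_norm.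
Qed.

Lemma integrable_cstr (k : R) : integrable (cst k).
Proof. exact: finite_measure_integrable_cst. Qed.

Lemma integrable_bounded f (k : R) : measurable_fun setT f ->
  (forall w, `|f w| <= k) -> integrable f.
Proof. by move=> mf fk; apply: integrable_dominated (integrable_cstr k). Qed.

Lemma integrable_mulbounded f g : measurable_fun setT g ->
  (forall w, `|g w| <= 1) -> integrable f -> integrable (fun w => g w * f w).
Proof.
move=> mg g1 fi; apply: (integrable_dominated _ _ (integrable_norm fi)).
  by apply: measurable_funM => //; exact: integrable_measurable.
by move=> w /=; rewrite normrM ler_piMl.
Qed.

Lemma integrable_addr f g :
  integrable f -> integrable g -> integrable (fun w => f w + g w).
Proof. by move=> fi gi; exact: (integrableD _ fi gi). Qed.

Lemma integrable_subr f g :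
  integrable f -> integrable g -> integrable (fun w => f w - g w).
Proof. by move=> fi gi; exact: (integrableB _ fi gi). Qed.

Lemma integrable_scaler (k : R) f :
  integrable f -> integrable (fun w => k * f w).
Proof. by move=> fi; exact: (integrableZl _ k fi). Qed.

Lemma integrable_sumr I (r : seq I) (Q : pred I) (F : I -> T -> R) :
  (forall i, Q i -> integrable (F i)) ->
  integrable (fun w => \sum_(i <- r | Q i) F i w).
Proof.
move=> Fi; elim: r => [|i r IH].
  apply: (eq_integrable measurableT _ _ _ (integrable_cstr 0)) => // w _.
  by rewrite /= big_nil.
have h : integrable (fun w => (if Q i then F i w else 0) + \sum_(j <- r | Q j) F j w).
  apply: integrable_addr => //; case Qi: (Q i); first exact: Fi.
  exact: integrable_cstr.
apply: (eq_integrable measurableT _ _ _ h) => // w _ /=.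
by rewrite big_cons; case: ifP => // _; rewrite add0r.
Qed.

Lemma Rintegral_sum I (r : seq I) (Q : pred I) (F : I -> T -> R) :
  (forall i, Q i -> integrable (F i)) ->
  \int[P]_w (\sum_(i <- r | Q i) F i w) = \sum_(i <- r | Q i) \int[P]_w F i w.
Proof.
move=> Fi; elim: r => [|i r IH].
  under eq_Rintegral do rewrite big_nil.
  by rewrite big_nil Rintegral_cst// mul0r.
rewrite big_cons; under eq_Rintegral do rewrite big_cons.
case: ifP => // Qi; rewrite RintegralD ?IH//; first exact: Fi.
exact: integrable_sumr.
Qed.

(** A finite upper bound on the extended integral of a nonnegative function
    gives integrability for free, and is then a bound between real numbers. *)
Lemma Rintegral_ge0_lee f (K : R) : measurable_fun setT f ->
  (forall w, 0 <= f w) -> (\int[P]_w (f w)%:E <= K%:E)%E ->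
  integrable f /\ \int[P]_w f w <= K.
Proof.
move=> mf f0 fK; have fi : integrable f.
  apply/integrableP; split; first exact/measurable_EFinP.
  rewrite (le_lt_trans _ (ltry K))// (le_trans _ fK)//.
  by under eq_integral do rewrite /= ger0_norm//.
split => //; rewrite -lee_fin /Rintegral fineK//.
exact: integrable_fin_num.
Qed.

Lemma Rintegral_indic (A : set T) : measurable A ->
  (\int[P]_w \1_A w)%:E = P A.
Proof.
move=> mA; rewrite /Rintegral fineK ?integral_indic ?setIT//.
exact: fin_num_measure.
Qed.

(** The sum is the integer part of x. *)
Lemma threshold_count (N : nat) (x : R) : 0 <= x <= N%:R ->
  x - 1 <= \sum_(k < N) (k.+1%:R <= x)%R%:R <= x.
Proof.
elim: N => [|N IH] /andP[x0 xN].
  by rewrite big_ord0 x0 andbT subr_le0 (le_trans xN).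
rewrite big_ord_recr/=.
have full : N%:R <= x -> \sum_(k < N) (k.+1%:R <= x)%R%:R = N%:R :> R.
  move=> Nx; rewrite (eq_bigr (fun=> 1)) => [|k _].
    by rewrite sumr_const card_ord.
  by rewrite (le_trans _ Nx)// ler_nat.
have [Nx|xN1] := leP N.+1%:R x.
  rewrite full; last by rewrite (le_trans _ Nx)// ler_nat.
  by move: Nx xN; rewrite /= mulr1n -natr1 => *; apply/andP; split; lra.
rewrite addr0; have [xN'|/ltW Nx] := leP x N%:R; first by apply: IH; rewrite x0.
by rewrite full//; move: Nx xN; rewrite -natr1 => *; apply/andP; split; lra.
Qed.

Section orthogonality.
Variables (G : set (set T)) (Z : T -> R).
Hypotheses (sG : sigma_algebra setT G) (GT : G `<=` measurable).
Hypotheses (Zi : integrable Z) (Z0 : forall A, G A -> \int[P]_(w in A) Z w = 0).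

Let mul_indicE (A : set T) : \int[P]_w (\1_A w * Z w) = \int[P]_(w in A) Z w.
Proof.
rewrite [RHS]Rintegral_mkcond; apply: eq_Rintegral => w _.
by rewrite patchE indicE; case: (w \in A); rewrite ?mul1r ?mul0r.
Qed.

(* Layer cake: g is within 1/N of the average of the N indicators of its level
   sets.  These sets lie in G, so every such average integrates to 0
   against Z. *)
Let unit_interval g : measurable_wrt G g -> (forall w, 0 <= g w <= 1) ->
  \int[P]_w (g w * Z w) = 0.
Proof.
move=> mg g01; have mgT := measurable_wrt_fun GT mg.
have g1 w : `|g w| <= 1 by have /andP[? ?] := g01 w; rewrite ger0_norm.
apply/eqP; rewrite -normr_le0; apply/ler_addgt0Pl => _ /posnumP[e].
rewrite addr0.
have [N] : exists N : nat, (\int[P]_w `|Z w|) / e%:num < N.+1%:R.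
  exists (Num.truncn ((\int[P]_w `|Z w|) / e%:num)).
  exact: truncnS_gt.
rewrite ltr_pdivrMr// => IN.
pose A (k : nat) := g @^-1` `[k.+1%:R / N.+1%:R, +oo[%classic.
have GA k : G (A k) by exact: mg.
have mA k : measurable (A k) by exact: GT.
pose gN w : R := N.+1%:R^-1 * \sum_(k < N.+1) \1_(A k) w.
have gNE w : `|g w - gN w| <= N.+1%:R^-1.
  have /andP[g0 g1'] := g01 w.
  have := @threshold_count N.+1 (g w * N.+1%:R).
  rewrite mulr_ge0//= ler_piMl// => /(_ isT).
  have AE k : (k.+1%:R <= g w * N.+1%:R) = (w \in A k).
    by rewrite -ler_pdivrMr//; apply/idP/idP; rewrite inE /A/= in_itv/= andbT.
  under eq_bigr do rewrite AE.
  rewrite /gN; under [in X in _ -> X]eq_bigr do rewrite indicE.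
  set s := \sum_(_ | _) _ => /andP[h1 h2].
  have N0 : 0 < N.+1%:R :> R by [].
  rewrite ger0_norm.
    rewrite -(ler_pM2l N0) mulrBr mulVKf ?mulfV//; lra.
  rewrite -(pmulr_rge0 _ N0) mulrBr mulVKf//; lra.
have mgN : measurable_fun setT gN.
  apply: measurable_funM => //; apply: measurable_sum => k.
  exact: measurable_indic.
have gNi : integrable (fun w => gN w * Z w).
  apply: (@integrable_dominated _ (fun w => (1 + 1) * `|Z w|)).
  - by apply: measurable_funM => //; exact: integrable_measurable.
  - move=> w; rewrite normrM ler_wpM2r//.
    rewrite (_ : gN w = g w - (g w - gN w)); last ring.
    rewrite (le_trans (ler_normB _ _))// lerD// (le_trans (gNE w))//.
    by rewrite invf_le1// ler1n.
  - exact/integrable_scaler/integrable_norm.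
have gN0 : \int[P]_w (gN w * Z w) = 0.
  rewrite /gN; under eq_Rintegral do rewrite -mulrA mulr_suml.
  have iA k : integrable (fun w => \1_(A k) w * Z w).
    apply: integrable_mulbounded => // w.
    by rewrite indicE ger0_norm// lern1; case: (_ \in _).
  rewrite RintegralZl//; last exact: integrable_sumr.
  rewrite Rintegral_sum//; rewrite big1 ?mulr0// => k _.
  by rewrite mul_indicE Z0.
have gZi := integrable_mulbounded mgT g1 Zi.
rewrite -[X in `|X|]subr0 -gN0 -RintegralB//.
have di : integrable (fun w => g w * Z w - gN w * Z w) by exact: integrable_subr.
rewrite (le_trans (le_normr_Rintegral _ di))//.
apply: (@le_trans _ _ (\int[P]_w (N.+1%:R^-1 * `|Z w|))).
  apply: le_Rintegral => //; first exact: (integrable_norm di).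
    exact/integrable_scaler/integrable_norm.
  by move=> w _; rewrite -mulrBl normrM ler_wpM2r.
rewrite RintegralZl//; last exact: integrable_norm.
by rewrite mulrC ler_pdivrMr// mulrC ltW.
Qed.

(** Extends the defining identity of a conditional expectation, with Z the
    difference of a variable and its version, from indicators to bounded
    weights.  The affine map (g + 1) / 2 reduces it to weights in [0, 1]. *)
Lemma Rintegral_bounded_mul0 g : measurable_wrt G g ->
  (forall w, `|g w| <= 1) -> \int[P]_w (g w * Z w) = 0.
Proof.
move=> mg g1; have mgT := measurable_wrt_fun GT mg.
have GsetT : G setT by have [G0 GC _] := sG; have := GC _ G0; rewrite setD0.
have := @unit_interval (fun w => 2^-1 * (g w + 1)).
rewrite (_ : (fun w => _ * Z w) = (fun w => 2^-1 * (g w * Z w + Z w))); last first.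
  by apply/funext => w; ring.
have gZi := integrable_mulbounded mgT g1 Zi.
rewrite RintegralZl ?RintegralD// ?Z0//; last exact: integrable_addr.
rewrite addr0 => /(_ _ _)/eqP; rewrite mulf_eq0 invr_eq0 pnatr_eq0/=.
move=> H; apply/eqP/H.
  apply/(measurable_wrtP _ sG); apply: measurable_funM => //.
  by apply: measurable_funD => //; exact/(measurable_wrtP _ sG).
by move=> w; have := g1 w; rewrite ler_norml => /andP[? ?]; apply/andP; split; lra.
Qed.

End orthogonality.

End real_integration.

(** * Test fields against random vectors *)

Section linear_test.
Context {disp : measure_display} {T : measurableType disp} {R : realType}.
Variable P : probability T R.
Implicit Types (f : T -> R) (G : set (set T)).

Local Notation integrable f := (P.-integrable setT (EFin \o f)).

(** Discrete layer cake with levels at unit distance, a spacing at which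
    exponential tails are still summable. *)
Lemma excess_le_count (x m : R) (n : nat) : x - m <= n%:R ->
  Num.max (x - m) 0 <= \sum_(j < n) (m + j%:R <= x)%R%:R.
Proof.
elim: n => [|n IH] xn.
  by rewrite big_ord0 ge_max xn lexx.
have [xn'|xn'] := leP (x - m) n%:R.
  rewrite (le_trans (IH xn'))// big_ord_recr/= lerDl; exact: ler0n.
rewrite (eq_bigr (fun=> 1)) => [|j _].
  by rewrite sumr_const card_ord ge_max xn/=.
rewrite (_ : _ <= _ = true)//; have : j%:R <= n%:R :> R by rewrite ler_nat -ltnS.
lra.
Qed.

(** Integrating the level count turns a bound on the sum of the tail
    probabilities into a bound on the expected excess. *)
Lemma integral_excess_le f (m K : R) : measurable_fun setT f ->
  (forall n, (\sum_(j < n) P [set w | (m + j%:R <= f w)%R] <= K%:E)%E) ->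
  (\int[P]_w (Num.max (f w - m) 0)%:E <= K%:E)%E.
Proof.
move=> mf tail; pose A (j : nat) := [set w | (m + j%:R <= f w)%R].
have mA j : measurable (A j).
  rewrite (_ : A j = f @^-1` `[m + j%:R, +oo[%classic).
    by rewrite -[_ @^-1` _]setTI; exact: mf.
  by apply/seteqP; split => w; rewrite /A/= in_itv/= andbT.
have mI j : measurable_fun setT (fun w => (\1_(A j) w)%:E : \bar R).
  by apply/measurable_EFinP; exact: measurable_indic.
have I0 j w : (0 <= (\1_(A j) w)%:E :> \bar R)%E by rewrite lee_fin.
apply: (@le_trans _ _ (\int[P]_w (\sum_(j <oo) (\1_(A j) w)%:E : \bar R))%E).
  apply: ge0_le_integral => //=.
  - by move=> w _; rewrite lee_fin le_max lexx orbT.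
  - apply/measurable_EFinP; apply: measurable_maxr => //.
    by apply: measurable_funB.
  - exact: ge0_emeasurable_sum.
  - move=> w _; have /ltW := truncnS_gt (f w - m); set n := _.+1 => xn.
    apply: le_trans (nneseries_lim_ge n _); last by move=> *; exact: I0.
    rewrite big_mkord sumEFin lee_fin (le_trans (excess_le_count xn))//.
    apply: ler_sum => j _; rewrite indicE.
    by rewrite (_ : (w \in A j) = (m + j%:R <= f w)%R)//; apply/idP/idP; rewrite inE.
rewrite integral_nneseries//.
apply: lime_le.
  by apply: is_cvg_nneseries => n _ _; exact: integral_ge0.
apply: nearW => n; rewrite big_mkord; apply: le_trans (tail n).
by apply: lee_sum => j _; rewrite integral_indic// setIT.
Qed.

Section vectors.
Context {d : nat}.
Implicit Types X Y g : T -> 'rV[R]_d.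

Definition vmeasurable X := forall i, measurable_fun setT (fun w => X w 0 i).

Definition vintegrable X := forall i, integrable (fun w => X w 0 i).

Lemma vintegrable_measurable X : vintegrable X -> vmeasurable X.
Proof. by move=> iX i; exact: integrable_measurable (iX i). Qed.

Lemma vintegrable_enorm X : vmeasurable X ->
  integrable (fun w => enorm (X w)) -> vintegrable X.
Proof.
by move=> mX iX i; apply: integrable_dominated iX => // w; exact: coord_le_enorm.
Qed.

Lemma vmeasurableB X Y : vmeasurable X -> vmeasurable Y ->
  vmeasurable (fun w => X w - Y w).
Proof.
move=> mX mY i; rewrite (_ : (fun w => _) = fun w => X w 0 i - Y w 0 i).
  exact: measurable_funB.
by apply/funext => w; rewrite !mxE.
Qed.

Lemma integrable_dotv g X : vmeasurable g -> (forall w, enorm (g w) <= 1) ->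
  vintegrable X -> integrable (fun w => dotv (g w) (X w)).
Proof.
move=> mg g1 iX; apply: integrable_sumr => i _; apply: integrable_mulbounded => //.
by move=> w; rewrite (le_trans (coord_le_enorm _ _)).
Qed.

Lemma integrable_enorm_bounded g : vmeasurable g ->
  (forall w, enorm (g w) <= 1) -> integrable (fun w => enorm (g w)).
Proof.
move=> mg g1; apply: (@integrable_bounded _ _ _ _ _ 1).
  exact: measurable_enorm.
by move=> w; rewrite ger0_norm// enorm_ge0.
Qed.

Lemma vmeasurable_wrt_fun G X : G `<=` measurable ->
  vmeasurable_wrt G X -> vmeasurable X.
Proof. by move=> GT mX i; exact: measurable_wrt_fun (mX i). Qed.

(** By Cauchy-Schwarz, with |X| <= m + max(|X| - m, 0) and |g| <= 1 on the
    excess.  Only the part below m is charged to the mass of g, which is what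
    lets it be absorbed later. *)
Lemma Rintegral_dotv_le_excess g X (m K : R) : vmeasurable g -> vintegrable X ->
  (forall w, enorm (g w) <= 1) -> 0 <= m ->
  (forall n, (\sum_(j < n) P [set w | (m + j%:R <= enorm (X w))%R] <= K%:E)%E) ->
  \int[P]_w dotv (g w) (X w) <= m * \int[P]_w enorm (g w) + K.
Proof.
move=> mg iX g1 m0 tail.
have mX := measurable_enorm (vintegrable_measurable iX).
have [|w|ei eK] := @Rintegral_ge0_lee _ _ _ P (fun w => Num.max (enorm (X w) - m) 0) K
    _ _ (integral_excess_le mX tail).
- by apply: measurable_maxr => //; exact: measurable_funB.
- by rewrite le_max lexx orbT.
have gi := integrable_enorm_bounded mg g1.
rewrite (le_trans _ (lerD (lexx _) eK))// -RintegralZl// -RintegralD//; last first.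
  exact: integrable_scaler.
apply: le_Rintegral => //; first exact: integrable_dotv.
  by apply: integrable_addr => //; exact: integrable_scaler.
move=> w _; rewrite (le_trans (dotv_le_enorm _ _))//.
have := g1 w; have := enorm_ge0 (g w); have := enorm_ge0 (X w).
set x := enorm (X w); set y := enorm (g w) => x0 y0 y1.
have : x - m <= Num.max (x - m) 0 by rewrite le_max lexx.
have : 0 <= Num.max (x - m) 0 by rewrite le_max lexx orbT.
set z := Num.max _ _ => z0 z1; nra.
Qed.

(** Splitting at the level e: below it z is at most e, above it z is at most
    z (z / e)^(p - 1). *)
Lemma le_split_powR (z e p : R) : 0 <= z -> 0 < e -> 1 < p ->
  z <= e + e `^ (1 - p) * z `^ p.
Proof.
move=> z0 e0 p1; have [ze|ez] := leP z e.
  by rewrite (le_trans ze)// lerDl mulr_ge0// powR_ge0.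
apply: (@le_trans _ _ (e `^ (1 - p) * z `^ p)); last by rewrite lerDr ltW.
rewrite -[in z `^ p](subrK 1 p) (@powRD _ z); last first.
  by rewrite (gt_eqF (lt_trans e0 ez)) implybT.
rewrite powRr1// mulrA ler_peMl// -[1 - p]opprB powRN mulrC ler_pdivlMr ?powR_gt0//.
by rewrite mul1r ge0_ler_powR ?nnegrE// ?subr_ge0 ltW.
Qed.

(** Because g is known at the earlier time, X_t may be replaced by its
    conditional expectation Y, and only Y - X_s has to be paid for.  Splitting
    at the threshold e, rather than using Hoelder's inequality, keeps the
    estimate linear in the mass of g, so that it can be summed over grid times
    and levels. *)
Lemma Rintegral_dotv_increment G g Xs Xt Y (p e B : R) :
  sigma_algebra setT G -> G `<=` measurable ->
  is_vcondexp P G Xt Y -> vmeasurable_wrt G Xs -> vintegrable Xs ->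
  vmeasurable_wrt G g -> (forall w, enorm (g w) <= 1) -> 1 < p -> 0 < e ->
  ('E_P[fun w => (enorm (Y w - Xs w) `^ p)%R] <= B%:E)%E ->
  \int[P]_w dotv (g w) (Xs w) <=
    \int[P]_w dotv (g w) (Xt w) + e * \int[P]_w enorm (g w) + e `^ (1 - p) * B.
Proof.
move=> sG GT cY GXs iXs Gg g1 p1 e0; rewrite unlock => EB.
have mg := vmeasurable_wrt_fun GT Gg.
have iXt : vintegrable Xt by move=> i; have [] := cY i.
have iY : vintegrable Y by move=> i; have [_ []] := cY i.
have YXt : \int[P]_w dotv (g w) (Y w) = \int[P]_w dotv (g w) (Xt w).
  rewrite /dotv !Rintegral_sum; last 2 first.
  - move=> i _; apply: integrable_mulbounded => // w.
    exact: le_trans (coord_le_enorm _ _) (g1 w).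
  - move=> i _; apply: integrable_mulbounded => // w.
    exact: le_trans (coord_le_enorm _ _) (g1 w).
  apply: eq_bigr => i _; apply/eqP; rewrite -subr_eq0.
  have gi1 w : `|g w 0 i| <= 1 by exact: le_trans (coord_le_enorm _ _) (g1 w).
  rewrite -RintegralB//; try exact: integrable_mulbounded.
  under eq_Rintegral do rewrite -mulrBr.
  rewrite (@Rintegral_bounded_mul0 _ _ _ _ G (fun w => Y w 0 i - Xt w 0 i))//.
    exact: integrable_subr.
  move=> A GA; have mA := GT _ GA.
  rewrite RintegralB//; try exact: (integrableS measurableT).
  by have [_ [_ [_ h]]] := cY i; rewrite /Rintegral h// subrr.
have mD := measurable_enorm (vmeasurableB (vintegrable_measurable iY)
  (vintegrable_measurable iXs)).
have [||zi zB] := @Rintegral_ge0_lee _ _ _ P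
  (fun w => enorm (Y w - Xs w) `^ p) B _ _ EB.
- exact: (measurableT_comp (measurable_powR p) mD).
- by move=> w; rewrite powR_ge0.
have gi := integrable_enorm_bounded mg g1.
rewrite -YXt; apply: (@le_trans _ _
   (\int[P]_w dotv (g w) (Y w) + e * \int[P]_w enorm (g w) + e `^ (1 - p) * 
    \int[P]_w (enorm (Y w - Xs w) `^ p))); last first.
  by rewrite lerD2l ler_wpM2l// powR_ge0.
rewrite -addrA -!RintegralZl//.
have i1 := integrable_scaler e gi.
have i2 := integrable_scaler (e `^ (1 - p)) zi.
have i3 := integrable_dotv mg g1 iY.
have i4 := integrable_dotv mg g1 iXs.
rewrite -RintegralD// -RintegralD//; last exact: integrable_addr.
apply: le_Rintegral => //.
  by apply: integrable_addr => //; exact: integrable_addr.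
move=> w _; rewrite -lerBlDl -dotvBr (le_trans (dotv_le_enorm _ _))//.
have -> : enorm (Xs w - Y w) = enorm (Y w - Xs w).
  by rewrite -opprB -scaleN1r /enorm; congr Num.sqrt; apply: eq_bigr => i _;
    rewrite !mxE; ring.
have := le_split_powR (enorm_ge0 (Y w - Xs w)) e0 p1.
have := g1 w; have := enorm_ge0 (g w); have := enorm_ge0 (Y w - Xs w).
have : 0 <= e `^ (1 - p) * enorm (Y w - Xs w) `^ p by rewrite mulr_ge0// powR_ge0.
set a := e `^ _ * _; set x := enorm (Y w - Xs w); set y := enorm (g w) => *; nra.
Qed.

End vectors.

End linear_test.

(** * Chaining along dyadic grids *)

(** The grouping of one coarsening step: the odd index 2j + 1 joins its right
    neighbour 2j + 2, and the index 0 stays alone. *)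
Lemma sum_pairs (V : nmodType) (f : nat -> V) (M : nat) :
  \sum_(i < M.*2.+1) f i = f 0%N + \sum_(j < M) (f j.*2.+1 + f j.*2.+2).
Proof.
elim: M => [|M IH]; first by rewrite double0 big_ord1 big_ord0 addr0.
by rewrite doubleS 2!big_ord_recr/= IH [in RHS]big_ord_recr/= !addrA.
Qed.

Section first_hit.
Context {R : realType}.
Implicit Type h : nat -> R.

(** For h with values in {0, 1} this is the indicator that i is the first index
    with h i = 1.  The product form telescopes and is visibly measurable. *)
Definition first_hit h i : R := h i * \prod_(j < i) (1 - h j).

Lemma sum_first_hit h n : \sum_(i < n) first_hit h i = 1 - \prod_(i < n) (1 - h i).
Proof.
elim: n => [|n IH]; first by rewrite !big_ord0 subrr.
by rewrite !big_ord_recr/= IH /first_hit; ring.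
Qed.

Lemma first_hit_ge0 h i : (forall i, 0 <= h i <= 1) -> 0 <= first_hit h i.
Proof.
move=> h01; rewrite mulr_ge0//; first by have /andP[] := h01 i.
by apply: prodr_ge0 => j _; have /andP[_] := h01 j; rewrite subr_ge0.
Qed.

End first_hit.

Section chaining.
Context {disp : measure_display} {Omega : measurableType disp} {R : realType}.
Context {d : nat}.
Variables (P : probability Omega R) (F : R -> set (set Omega)).
Variables (T : R) (X : R -> Omega -> 'rV[R]_d) (p h A : R).
Hypotheses (filtF : filtration F) (adX : adapted F T X).
Hypotheses (incX : conditional_increment_control P F T X p h A) (p1 : 1 < p).

Variables (m K : R).
Hypotheses (m0 : 0 <= m).
Hypotheses (tailX : forall t : R, 0 <= t <= T ->
  forall n, (\sum_(j < n) P [set w | (m + j%:R <= enorm (X t w))%R] <= K%:E)%E).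

Let F_sigma (t : R) : 0 <= t -> sigma_algebra setT (F t).
Proof. by move=> t0; have [+ _] := filtF; exact. Qed.

Let F_meas (t : R) : 0 <= t -> F t `<=` measurable.
Proof. by move=> t0; have [_ [+ _]] := filtF; exact. Qed.

Let F_mono (s t : R) : 0 <= s -> s <= t -> F s `<=` F t.
Proof. by move=> s0 st; have [_ [_]] := filtF; exact. Qed.

Let mX (t : R) : 0 <= t <= T -> vmeasurable (X t).
Proof.
move=> tT; apply: vmeasurable_wrt_fun (adX tT).
by apply: F_meas; case/andP: tT.
Qed.

Let iX (t : R) : 0 <= t <= T -> vintegrable P (X t).
Proof.
move=> tT; have mEX := measurable_enorm (mX tT).
apply: vintegrable_enorm; first exact: mX.
have [|w|ei _] := @Rintegral_ge0_lee _ _ _ P (fun w => Num.max (enorm (X t w) - m) 0) K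
    _ _ (integral_excess_le mEX (tailX tT)).
- by apply: measurable_maxr => //; exact: measurable_funB.
- by rewrite le_max lexx orbT.
apply: (integrable_dominated mEX _ (integrable_addr (integrable_cstr P m) ei)) => w.
rewrite ger0_norm ?enorm_ge0//= -lerBlDl le_max lexx//.
Qed.

Variables (N : nat) (delta : R).
Hypotheses (delta0 : 0 < delta) (T_E : T = N%:R * delta).

Definition gridpt (n i : nat) : R := i%:R * (delta / 2 ^+ n).

Lemma gridpt_ge0 n i : 0 <= gridpt n i.
Proof. by rewrite mulr_ge0// divr_ge0 ?ltW// exprn_gt0. Qed.

Lemma gridpt_double n i : gridpt n.+1 i.*2 = gridpt n i.
Proof. by rewrite /gridpt -muln2 natrM exprS; field; rewrite expf_neq0. Qed.

Lemma gridpt_gap n i : gridpt n i.+1 - gridpt n i = delta / 2 ^+ n.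
Proof. by rewrite /gridpt -natr1; ring. Qed.

Lemma gridpt_in n i : (i <= N * 2 ^ n)%N -> 0 <= gridpt n i <= T.
Proof.
move=> iN; rewrite gridpt_ge0/= T_E.
rewrite (_ : N%:R * delta = (N * 2 ^ n)%:R * (delta / 2 ^+ n)).
  by rewrite ler_wpM2r ?ler_nat// divr_ge0 ?ltW// exprn_gt0.
by rewrite natrM natrX; field; rewrite expf_neq0.
Qed.

Lemma vmeasurable_wrtD G (g g' : Omega -> 'rV[R]_d) : sigma_algebra setT G ->
  vmeasurable_wrt G g -> vmeasurable_wrt G g' ->
  vmeasurable_wrt G (fun w => g w + g' w).
Proof.
move=> sG mg mg' i; apply/measurable_wrtP => //.
rewrite (_ : (fun w => _) = fun w => g w 0 i + g' w 0 i).
  by apply: measurable_funD; exact/measurable_wrtP.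
by apply/funext => w; rewrite mxE.
Qed.

Lemma vmeasurable_wrt_sub G G' (g : Omega -> 'rV[R]_d) : G `<=` G' ->
  vmeasurable_wrt G g -> vmeasurable_wrt G' g.
Proof. by move=> GG' mg i B mB; apply: GG'; exact: mg. Qed.

Variables (e : nat -> R).
Hypothesis e0 : forall n, 0 < e n.

Definition mass n (g : nat -> Omega -> 'rV[R]_d) : R :=
  \sum_(i < (N * 2 ^ n).+1) \int[P]_w enorm (g i w).

(** Price of coarsening level n + 1 to level n: N 2^n moves of length
    delta / 2^(n + 1), each contributing its p-th moment term. *)
Definition step_error n : R :=
  (N * 2 ^ n)%:R * (e n `^ (1 - p) * (A * (delta / 2 ^+ n.+1) `^ (p * h))).

(** One coarsening step merges the field at each odd time into the field at the
    next even time.  The merged field is measurable at the later time and its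
    length is at most the sum of the two lengths, so the hypotheses persist and
    the mass does not grow.  At level 0 the marginal tails at the N + 1 coarse
    times finish the estimate. *)
Lemma chaining n (g : nat -> Omega -> 'rV[R]_d) :
  (forall i, (i <= N * 2 ^ n)%N -> vmeasurable_wrt (F (gridpt n i)) (g i)) ->
  (forall w, \sum_(i < (N * 2 ^ n).+1) enorm (g i w) <= 1) ->
  \sum_(i < (N * 2 ^ n).+1) \int[P]_w dotv (g i w) (X (gridpt n i) w) <=
  (m + \sum_(k < n) e k) * mass n g + N.+1%:R * K + \sum_(k < n) step_error k.
Proof.
elim: n g => [|n IH] g mg g1.
  have g1' i w : (i <= N * 2 ^ 0)%N -> enorm (g i w) <= 1.
    move=> iN; apply: le_trans (g1 w).
    rewrite (bigD1 (Ordinal (iN : (i < (N * 2 ^ 0).+1)%N)))//= lerDl.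
    by apply: sumr_ge0 => j _; exact: enorm_ge0.
  rewrite !big_ord0 !addr0 /mass mulr_sumr.
  have -> : N.+1%:R * K = \sum_(i < (N * 2 ^ 0).+1) K.
    by rewrite sumr_const card_ord expn0 muln1 mulr_natl.
  rewrite -big_split/=; apply: ler_sum => -[i /= iN] _.
  have tT := gridpt_in iN.
  apply: Rintegral_dotv_le_excess => //.
  - by apply: vmeasurable_wrt_fun (mg _ iN); apply: F_meas; case/andP: tT.
  - exact: iX.
  - by move=> w; exact: g1'.
  - exact: tailX.
have N2 : (N * 2 ^ n.+1)%N = (N * 2 ^ n).*2 by rewrite expnS mulnCA mul2n.
pose M := (N * 2 ^ n)%N.
have g1' i w : (i <= M.*2)%N -> enorm (g i w) <= 1.
  move=> iN; apply: le_trans (g1 w); rewrite N2.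
  rewrite (bigD1 (Ordinal (iN : (i < M.*2.+1)%N)))//= lerDl.
  by apply: sumr_ge0 => j _; exact: enorm_ge0.
have mg' i : (i <= M.*2)%N -> vmeasurable (g i).
  move=> iN; apply: (@vmeasurable_wrt_fun _ _ _ _ (F (gridpt n.+1 i))).
    exact/F_meas/gridpt_ge0.
  by apply: mg; rewrite N2.
have j1 j : (j < M)%N -> (j.*2.+1 <= M.*2)%N by move=> jM; rewrite ltn_double.
have j2 j : (j < M)%N -> (j.*2.+2 <= M.*2)%N by move=> jM; rewrite -doubleS leq_double.
(* The field of level n obtained by merging 2k + 1 into 2k + 2. *)
pose g' j := if j is k.+1 then fun w => g k.*2.+1 w + g k.*2.+2 w else g 0%N.
have mass_g' : mass n g' <= mass n.+1 g.
  rewrite /mass N2 (sum_pairs (fun i => \int[P]_w enorm (g i w))) big_ord_recl/= lerD2l.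
  apply: ler_sum => -[j /= jM] _.
  have i1 := integrable_enorm_bounded P (mg' _ (j1 _ jM)) (fun w => g1' _ w (j1 _ jM)).
  have i2 := integrable_enorm_bounded P (mg' _ (j2 _ jM)) (fun w => g1' _ w (j2 _ jM)).
  rewrite -RintegralD//; apply: le_Rintegral => //.
  - apply: (integrable_dominated _ _ (integrable_addr i1 i2)) => [|w].
      apply: measurable_enorm => i.
      rewrite (_ : (fun w => _) = fun w => g j.*2.+1 w 0 i + g j.*2.+2 w 0 i).
        by apply: measurable_funD; apply: mg'; auto.
      by apply/funext => w; rewrite mxE.
    by rewrite ger0_norm ?enorm_ge0//; exact: ler_enormD.
  - exact: integrable_addr.
  - by move=> w _; exact: ler_enormD.
have step j : (j < M)%N ->
  \int[P]_w dotv (g j.*2.+1 w) (X (gridpt n.+1 j.*2.+1) w) <=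
  \int[P]_w dotv (g j.*2.+1 w) (X (gridpt n j.+1) w) +
  e n * \int[P]_w enorm (g j.*2.+1 w) +
  e n `^ (1 - p) * (A * (delta / 2 ^+ n.+1) `^ (p * h)).
  move=> jM; have gap := gridpt_gap n.+1 j.*2.+1.
  have d0 : 0 < delta / 2 ^+ n.+1 by rewrite divr_gt0// exprn_gt0.
  have sT : 0 <= gridpt n.+1 j.*2.+1 <= T by apply: gridpt_in; rewrite N2; exact: j1.
  have tT : 0 <= gridpt n.+1 j.*2.+2 <= T by apply: gridpt_in; rewrite N2; exact: j2.
  have [_ /(_ (gridpt n.+1 j.*2.+1) (gridpt n.+1 j.*2.+2))] := incX.
  rewrite gap ger0_norm ?(ltW d0)//.
  have /andP[s0 _] := sT; have /andP[_ tT'] := tT.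
  rewrite -subr_gt0 gap => /(_ s0 d0 tT')[Y [cY EY]].
  rewrite -[gridpt n j.+1]gridpt_double.
  apply: (Rintegral_dotv_increment (F_sigma s0) (F_meas s0) cY (adX sT) (iX sT)) => //.
  - by apply: mg; rewrite N2; exact: j1.
  - by move=> w; apply: g1'; exact: j1.
have IHg' : \sum_(i < M.+1) \int[P]_w dotv (g' i w) (X (gridpt n i) w) <=
    (m + \sum_(k < n) e k) * mass n g' + N.+1%:R * K + \sum_(k < n) step_error k.
  apply: IH => [i iM|w].
    case: i iM => [_|i iM] /=.
      by have := mg 0%N; rewrite /gridpt !mul0r; exact.
    have iM1 : (i.*2.+1 <= N * 2 ^ n.+1)%N by rewrite N2; exact: j1.
    have iM2 : (i.*2.+2 <= N * 2 ^ n.+1)%N by rewrite N2; exact: j2.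
    apply: vmeasurable_wrtD; first exact/F_sigma/gridpt_ge0.
      apply: vmeasurable_wrt_sub (mg _ iM1); apply: F_mono; first exact: gridpt_ge0.
      rewrite -[leRHS]gridpt_double -subr_ge0 gridpt_gap.
      by rewrite divr_ge0 ?ltW// exprn_gt0.
    by have := mg _ iM2; rewrite -doubleS gridpt_double.
  apply: le_trans (g1 w); rewrite N2 (sum_pairs (fun i => enorm (g i w))).
  rewrite big_ord_recl/= lerD2l.
  by apply: ler_sum => j _; exact: ler_enormD.
have e_mass : \sum_(j < M) \int[P]_w enorm (g j.*2.+1 w) <= mass n.+1 g.
  rewrite /mass N2 (sum_pairs (fun i => \int[P]_w enorm (g i w))) -[leLHS]add0r lerD//.
    by apply: Rintegral_ge0 => w _; exact: enorm_ge0.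
  apply: ler_sum => j _; rewrite lerDl.
  by apply: Rintegral_ge0 => w _; exact: enorm_ge0.
have {}IHg' : \int[P]_w dotv (g 0%N w) (X (gridpt n 0) w) +
    \sum_(j < M) \int[P]_w dotv (g j.*2.+1 w + g j.*2.+2 w) (X (gridpt n j.+1) w) <=
    (m + \sum_(k < n) e k) * mass n g' + N.+1%:R * K + \sum_(k < n) step_error k.
  by move: IHg'; rewrite big_ord_recl.
rewrite N2 (sum_pairs (fun i => \int[P]_w dotv (g i w) (X (gridpt n.+1 i) w))) -/M.
apply: (@le_trans _ _ (\int[P]_w dotv (g 0%N w) (X (gridpt n 0) w) +
  \sum_(j < M) (\int[P]_w dotv (g j.*2.+1 w + g j.*2.+2 w) (X (gridpt n j.+1) w)
   + (e n * \int[P]_w enorm (g j.*2.+1 w) +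
      e n `^ (1 - p) * (A * (delta / 2 ^+ n.+1) `^ (p * h)))))).
  have gp0 k : gridpt k 0 = 0 by rewrite /gridpt mul0r.
  rewrite !gp0 lerD2l; apply: ler_sum => -[j /= jM] _.
  have tT : 0 <= gridpt n j.+1 <= T by exact: gridpt_in.
  have i1 := integrable_dotv (mg' _ (j1 _ jM)) (fun w => g1' _ w (j1 _ jM)) (iX tT).
  have i2 := integrable_dotv (mg' _ (j2 _ jM)) (fun w => g1' _ w (j2 _ jM)) (iX tT).
  under [X in _ <= X + _]eq_Rintegral do rewrite dotvDl.
  rewrite RintegralD//.
  have := step _ jM; rewrite -[gridpt n.+1 j.*2.+2]/(gridpt n.+1 j.+1.*2) gridpt_double.
  lra.
rewrite big_split/= big_split/= -mulr_sumr sumr_const card_ord -[_ *+ M]mulr_natl.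
rewrite !(big_ord_recr n)/= -/(step_error n).
have s0 : 0 <= \sum_(k < n) e k by apply: sumr_ge0 => k _; exact: ltW.
have := ler_wpM2l (addr_ge0 m0 s0) mass_g'.
have := ler_wpM2l (ltW (e0 n)) e_mass.
move: IHg'; rewrite [step_error n]/step_error -/M; lra.
Qed.

Definition grid_hits n (ell : R) :=
  [set w | exists2 i, (i <= N * 2 ^ n)%N & ell <= enorm (X (gridpt n i) w)].

Lemma measurable_hit t (ell : R) : 0 <= t <= T ->
  F t [set w | ell <= enorm (X t w)].
Proof.
move=> tT; have /andP[t0 _] := tT; have sF := F_sigma t0.
have mEX : measurable_wrt (F t) (fun w => enorm (X t w)).
  apply/measurable_wrtP => //.
  by apply: measurable_enorm => i; apply/measurable_wrtP => //; exact: adX.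
have := mEX `[ell, +oo[%classic (measurable_itv _).
rewrite (_ : _ @^-1` _ = [set w | ell <= enorm (X t w)])//.
by apply/seteqP; split => w /=; rewrite in_itv/= andbT.
Qed.

Lemma measurable_grid_hits n ell : measurable (grid_hits n ell).
Proof.
rewrite (_ : grid_hits n ell = \bigcup_(i in `I_(N * 2 ^ n).+1)
   [set w | ell <= enorm (X (gridpt n i) w)]).
  apply: bigcup_measurable => i iN; apply: (F_meas (gridpt_ge0 n i)).
  by apply: measurable_hit; exact: gridpt_in.
by apply/seteqP; split=> w [i iN iw]; exists i.
Qed.

(** Chaining applied to the unit vectors X / |X| stopped at the first hit.  The
    mass of these fields is at most the probability of a hit, so it is absorbed
    into the left-hand side, where the pairing contributes ell per unit of
    probability. *)
Lemma grid_maximal n (ell : R) : 0 < ell ->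
  (ell - m - \sum_(k < n) e k) * fine (P (grid_hits n ell)) <=
  N.+1%:R * K + \sum_(k < n) step_error k.
Proof.
move=> ell0; pose H i := [set w | ell <= enorm (X (gridpt n i) w)].
pose hit w i : R := \1_(H i) w.
have hit01 w i : 0 <= hit w i <= 1.
  by rewrite /hit indicE; case: (_ \in _); rewrite ?lexx ler01.
pose g i w := first_hit (hit w) i *: ((enorm (X (gridpt n i) w))^-1 *: X (gridpt n i) w).
have fh0 w i := first_hit_ge0 i (hit01 w).
have g_le i w : enorm (g i w) <= first_hit (hit w) i.
  by rewrite enormZ// ler_piMr// enorm_unit.
have gX_ge i w : ell * first_hit (hit w) i <= dotv (g i w) (X (gridpt n i) w).
  rewrite dotvZl dotv_unit mulrC.
  have [iw|iw] := boolP (w \in H i).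
    by rewrite ler_wpM2l//; move: iw; rewrite inE.
  by rewrite /first_hit /hit indicE (negbTE iw) !mul0r.
have sum_hit w : \sum_(i < (N * 2 ^ n).+1) first_hit (hit w) i = \1_(grid_hits n ell) w.
  rewrite sum_first_hit indicE; have [|wn] := boolP (w \in grid_hits n ell).
    rewrite inE => -[i iN iw]; rewrite (bigD1 (Ordinal (iN : (i < _.+1)%N)))//=.
    by rewrite /hit indicE mem_set// subrr mul0r subr0.
  rewrite big1 ?subrr// => -[i /= iN] _; rewrite /hit indicE memNset ?subr0//.
  by move=> iw; move/negP: wn; apply; rewrite inE; exists i.
have mg i : (i <= N * 2 ^ n)%N -> vmeasurable_wrt (F (gridpt n i)) (g i).
  move=> iN k; have sF := F_sigma (gridpt_ge0 n i).
  have mH j : (j <= i)%N -> measurable_fun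
      [set: g_sigma_algebraType (F (gridpt n i))] (fun w => hit w j).
    move=> ji; apply: measurable_indic; apply: sub_sigma_algebra.
    apply: (@F_mono (gridpt n j)); first exact: gridpt_ge0.
      by rewrite ler_wpM2r ?ler_nat// divr_ge0 ?ltW// exprn_gt0.
    by apply: measurable_hit; apply: gridpt_in; exact: leq_trans iN.
  have mXi : forall l, measurable_fun [set: g_sigma_algebraType (F (gridpt n i))]
      (fun w => X (gridpt n i) w 0 l).
    by move=> l; apply/measurable_wrtP => //; apply: adX; exact: gridpt_in.
  apply/measurable_wrtP => //.
  rewrite (_ : (fun w => _) = fun w => first_hit (hit w) i *
      (enorm (X (gridpt n i) w) `^ (-1) * X (gridpt n i) w 0 k)); last first.
    by apply/funext => w; rewrite !mxE powR_inv1// enorm_ge0.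
  apply: measurable_funM; last first.
    apply: measurable_funM => //.
    exact: (measurableT_comp (measurable_powR (-1)) (measurable_enorm mXi)).
  apply: measurable_funM; first exact: mH.
  apply: measurable_prod => -[j /= ji] _.
  by apply: measurable_funB => //; apply: mH; exact: ltnW.
have g1 w : \sum_(i < (N * 2 ^ n).+1) enorm (g i w) <= 1.
  apply: (@le_trans _ _ (\sum_(i < (N * 2 ^ n).+1) first_hit (hit w) i)).
    by apply: ler_sum => i _; exact: g_le.
  by rewrite sum_hit indicE; case: (_ \in _).
have g1' i w : (i <= N * 2 ^ n)%N -> enorm (g i w) <= 1.
  move=> iN; apply: le_trans (g1 w).
  rewrite (bigD1 (Ordinal (iN : (i < (N * 2 ^ n).+1)%N)))//= lerDl.
  by apply: sumr_ge0 => j _; exact: enorm_ge0.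
have mgT i : (i <= N * 2 ^ n)%N -> vmeasurable (g i).
  by move=> iN; apply: vmeasurable_wrt_fun (mg _ iN); exact/F_meas/gridpt_ge0.
have mG := measurable_grid_hits n ell.
have iG := integrable_indic P mG.
have PG : fine (P (grid_hits n ell)) = \int[P]_w \1_(grid_hits n ell) w.
  by rewrite -(Rintegral_indic P mG).
have i1 : forall i : 'I_(N * 2 ^ n).+1, true ->
    P.-integrable setT (EFin \o (fun w => enorm (g i w))).
  move=> -[i /= iN] _; apply: integrable_enorm_bounded; first exact: mgT.
  by move=> w; exact: g1'.
have i2 : forall i : 'I_(N * 2 ^ n).+1, true ->
    P.-integrable setT (EFin \o (fun w => dotv (g i w) (X (gridpt n i) w))).
  move=> -[i /= iN] _; apply: integrable_dotv; first exact: mgT.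
    by move=> w; exact: g1'.
  by apply: iX; exact: gridpt_in.
have mass_le : mass n g <= fine (P (grid_hits n ell)).
  rewrite PG /mass -Rintegral_sum//; apply: le_Rintegral => //.
    exact: integrable_sumr.
  by move=> w _; rewrite -sum_hit; apply: ler_sum => i _; exact: g_le.
have test_ge : ell * fine (P (grid_hits n ell)) <=
    \sum_(i < (N * 2 ^ n).+1) \int[P]_w dotv (g i w) (X (gridpt n i) w).
  rewrite PG -RintegralZl// -Rintegral_sum//; apply: le_Rintegral => //.
  - exact: integrable_scaler.
  - exact: integrable_sumr.
  - by move=> w _; rewrite -sum_hit mulr_sumr; apply: ler_sum => i _; exact: gX_ge.
have := chaining mg g1.
have s0 : 0 <= \sum_(k < n) e k by apply: sumr_ge0 => k _; exact: ltW.
have := ler_wpM2l (addr_ge0 m0 s0) mass_le.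
move: test_ge; lra.
Qed.

End chaining.

(** * From grids to the supremum over continuous paths *)

Section path_supremum.
Context {disp : measure_display} {Omega : measurableType disp} {R : realType}.
Context {d : nat}.
Variables (P : probability Omega R) (F : R -> set (set Omega)).
Variables (T : R) (X : R -> Omega -> 'rV[R]_d).
Hypotheses (filtF : filtration F) (adX : adapted F T X).
Variables (N : nat) (delta : R).
Hypotheses (delta0 : 0 < delta) (T_E : T = N%:R * delta).

Local Notation hits := (grid_hits X N delta).

Lemma grid_hits_nondecreasing (ell : R) : nondecreasing_seq (hits ^~ ell).
Proof.
apply/nondecreasing_seqP => n; apply/subsetPset => w [i iN iw].
exists i.*2; first by rewrite expnS mulnCA mul2n leq_double.
by rewrite gridpt_double.
Qed.

Lemma grid_hits_sup n (ell : R) w : hits n ell w -> (ell%:E <= sup_enorm T X w)%E.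
Proof.
move=> [i iN iw]; apply: (@le_trans _ _ (enorm (X (gridpt delta n i) w))%:E).
  by rewrite lee_fin.
apply: ereal_sup_ubound; exists (gridpt delta n i) => //=.
by rewrite in_itv/=; exact: gridpt_in iN.
Qed.

(** The witness is the grid point just left of t at a level of mesh below e. *)
Lemma gridpt_dense (t e : R) : 0 <= t <= T -> 0 < e ->
  exists n i, (i <= N * 2 ^ n)%N /\ `|t - gridpt delta n i| < e.
Proof.
move=> /andP[t0 tT] e0.
have [n n_e] : exists n : nat, delta / e < 2 ^+ n.
  exists (Num.truncn (delta / e)).+1.
  rewrite (lt_trans (truncnS_gt _))// -natrX ltr_nat; exact: ltn_expl.
have dn0 : 0 < delta / 2 ^+ n by rewrite divr_gt0// exprn_gt0.
have dn_e : delta / 2 ^+ n < e.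
  by rewrite ltr_pdivrMr ?exprn_gt0// mulrC -ltr_pdivrMr.
have q0 : 0 <= t / (delta / 2 ^+ n) by rewrite divr_ge0// ltW.
have /andP[] := truncn_itv q0; set i := Num.truncn _ => il iu.
exists n, i; split.
  rewrite -(ler_nat R) (le_trans il)// ler_pdivrMr// (le_trans tT)//.
  rewrite T_E natrM natrX le_eqVlt; apply/orP; left; apply/eqP; field.
  by rewrite expf_neq0.
rewrite ler_pdivlMr// in il; rewrite ltr_pdivrMr// -natr1 in iu.
by rewrite /gridpt ger0_norm; lra.
Qed.

Lemma sup_grid_hits (ell : R) w :
  {within `[0, T], continuous (fun t => X t w)} ->
  (ell%:E < sup_enorm T X w)%E -> exists n, hits n ell w.
Proof.
move=> cX /ereal_sup_gt[_ [t /= tT <-]]; rewrite lte_fin => ell_t.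
have cf : (fun s => enorm (X s w)) @ within [set` `[0, T]] (nbhs t) --> enorm (X t w).
  apply: (cvg_comp _ _ (proj1 (subspace_continuousP _ _) cX t tT)).
  exact: continuous_enorm.
have : within [set` `[0, T]] (nbhs t) [set s | ell < enorm (X s w)].
  exact: (cf [set y | ell < y] (lt_nbhsr ell_t)).
rewrite /within/= => /nbhs_ballP[e /= e0 eb].
have tT' : 0 <= t <= T by move: tT; rewrite in_itv.
have [n [i [iN ti]]] := gridpt_dense tT' e0.
exists n, i => //; apply/ltW/eb => //=.
by rewrite in_itv/=; exact: gridpt_in iN.
Qed.

(** The event exceeds a set B, built from countably many grid events, only by
    discontinuous paths.  Completeness of P makes that null difference
    measurable. *)
Lemma measurable_sup_event (lambda : R) : measure_is_complete P ->
  continuous_process P T X ->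
  measurable [set w | (lambda%:E <= sup_enorm T X w)%E].
Proof.
move=> cP cX; set S := [set w | _].
pose B := \bigcap_(k : nat) \bigcup_(n : nat) hits n (lambda - k.+1%:R^-1).
have mB : measurable B.
  apply: bigcap_measurable => [|k _]; first by exists 0%N.
  by apply: bigcup_measurable => n _; apply: (measurable_grid_hits filtF adX).
have BS : B `<=` S.
  move=> w Bw; rewrite /S/=; apply/lee_subgt0Pr => _ /posnumP[e].
  have [k ke] : exists k : nat, k.+1%:R^-1 < e%:num :> R.
    exists (Num.truncn (e%:num^-1)); rewrite invf_plt ?posrE//; exact: truncnS_gt.
  have [n _ Bn] := Bw k I.
  by apply: le_trans (grid_hits_sup Bn); rewrite -EFinB lee_fin lerD2l lerN2 ltW.
have SB : P.-negligible (S `\` B).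
  apply: negligibleS cX => v [Sw nBw] /= cw; apply: nBw => j _.
  have [|q vq] := @sup_grid_hits (lambda - j.+1%:R^-1) v cw; last by exists q.
  by apply: lt_le_trans Sw; rewrite lte_fin ltrBlDr ltrDl.
rewrite -(setDUK BS); apply: measurableU => //; exact: cP.
Qed.

(** On a continuous path a supremum of at least lambda forces a hit of any lower
    level at some dyadic grid, and the hit events increase with the level of
    the grid. *)
Lemma sup_event_le (lambda ell b : R) : measure_is_complete P ->
  continuous_process P T X -> ell < lambda ->
  (forall n, fine (P (hits n ell)) <= b) ->
  (P [set w | (lambda%:E <= sup_enorm T X w)%E] <= b%:E)%E.
Proof.
move=> cP cX ell_lam Pb; have mS := measurable_sup_event lambda cP cX.
have mH n : measurable (hits n ell) by exact: (measurable_grid_hits filtF adX).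
have [Z [mZ Z0 cZ]] := cX.
pose U := \bigcup_n hits n ell.
have mU : measurable U by exact: bigcup_measurable.
apply: (@le_trans _ _ (P (U `|` Z))).
  apply: le_measure; rewrite ?inE//; first exact: measurableU.
  move=> w Sw; have [Zw|nZw] := pselect (Z w); [by right|left].
  have cw : {within `[0, T], continuous (fun t => X t w)}.
    by apply: contrapT => ncw; apply: nZw; exact: cZ.
  have [|n wn] := @sup_grid_hits ell w cw; last by exists n.
  by apply: lt_le_trans Sw; rewrite lte_fin.
apply: (@le_trans _ _ (P U + P Z)%E); first exact: measureU2.
rewrite Z0 adde0.
have cU := nondecreasing_cvg_mu (mu := P) mH mU (grid_hits_nondecreasing ell).
rewrite -(cvg_lim _ cU)//; apply: lime_le.
  by apply: ereal_nondecreasing_is_cvgn => i j ij; apply: le_measure; rewrite ?inE//;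
    apply/subsetPset; exact: grid_hits_nondecreasing.
by apply: nearW => n /=; rewrite -[P _]fineK ?fin_num_measure// lee_fin.
Qed.

End path_supremum.

(** * Explicit estimates *)

Section estimates.
Context {R : realType}.

(** With k = s / alpha this is exp(y) >= 1 + y >= y at y = c x^alpha / k, raised
    to the power k. *)
Lemma expR_powR_decay (c alpha s : R) : 0 < c -> 0 < alpha -> 0 < s ->
  exists2 M : R, 0 <= M &
    forall x : R, 0 < x -> expR (- (c * x `^ alpha)) <= M * x `^ (- s).
Proof.
move=> c0 a0 s0; pose k := s / alpha; have k0 : 0 < k by rewrite divr_gt0.
exists ((c / k) `^ (- k)); first exact: powR_ge0.
move=> x x0; have xa0 : 0 < x `^ alpha by rewrite powR_gt0.
pose y := c / k * x `^ alpha; have y0 : 0 < y by rewrite mulr_gt0// divr_gt0.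
have -> : c * x `^ alpha = y * k by rewrite /y; field; rewrite gt_eqF.
rewrite (_ : - s = alpha * - k); last by rewrite /k; field; rewrite gt_eqF.
have ck0 : 0 <= c / k by rewrite divr_ge0 ?ltW.
rewrite powRrM -powRM ?powR_ge0// -/y.
rewrite expRN powRN lef_pV2 ?posrE ?expR_gt0 ?powR_gt0// expRM.
apply: ge0_ler_powR; rewrite ?nnegrE ?expR_ge0 ?(ltW y0) ?(ltW k0)//.
by rewrite (le_trans _ (expR_ge1Dx y))// lerDr.
Qed.

(** Telescoping: 1 / (n+2)^2 is at most 1 / (n+1) - 1 / (n+2). *)
Lemma sum_inv_sqr_le (n : nat) : \sum_(j < n) j.+1%:R `^ (- 2%:R) <= 2 :> R.
Proof.
case: n => [|n]; first by rewrite big_ord0.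
suff : \sum_(j < n.+1) j.+1%:R `^ (- 2%:R) <= 2 - n.+1%:R^-1 :> R.
  by move=> /le_trans -> //; rewrite gerBl invr_ge0.
elim: n => [|n IH]; first by rewrite big_ord1 powR1 invr1; lra.
rewrite big_ord_recr/= (le_trans (lerD IH (lexx _)))// powR_invn//.
rewrite -[n.+2%:R]natr1; set y := n.+1%:R : R; have y0 : 0 < y by [].
clearbody y.
rewrite -subr_ge0.
rewrite (_ : _ - _ = (y * (y + 1) ^+ 2)^-1); last first.
  by field; rewrite !gt_eqF ?addr_gt0.
by rewrite invr_ge0 mulr_ge0 ?exprn_ge0 ?addr_ge0// ltW.
Qed.

Lemma geometric_sum_le (q : R) (n : nat) : 0 < q < 1 ->
  (1 - q) * \sum_(k < n) q ^+ k <= 1.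
Proof.
move=> /andP[q0 q1]; have := subrX1 q n.
have : 0 <= q ^+ n by rewrite exprn_ge0 ?ltW.
lra.
Qed.

Lemma powR2N_lt1 (g : R) : 0 < g -> 2 `^ (- g) < 1.
Proof.
move=> g0; rewrite /powR pnatr_eq0/= -[ltRHS]expR0 ltr_expR nmulr_rlt0 ?oppr_lt0//.
by rewrite ln_gt0 ?ltr1n.
Qed.

(** The ratio q = 2^(-(ph - 1)/p) makes thresholds and errors decay at the same
    rate.  Up to constants the error of level k is
    2^k q^(k (1 - p)) 2^(-k ph), and its exponent of 2 is
    k (1 + (ph - 1)(p - 1)/p - ph) = - k (ph - 1)/p, so the error is q^k. *)
Lemma step_error_geometric (p h A delta L q : R) (N n : nat) :
  1 < p -> 1 < p * h -> 0 <= A -> 0 < delta -> 0 < L ->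
  q = 2 `^ (- ((p * h - 1) / p)) ->
  \sum_(k < n) step_error p h A N delta (fun k => L * (1 - q) * q ^+ k) k <=
  N%:R * A * delta `^ (p * h) * L `^ (1 - p) * (1 - q) `^ (- p).
Proof.
move=> p1 ph1 A0 d0 L0 qE; have p0 : 0 < p by rewrite (lt_trans ltr01).
have q0 : 0 < q by rewrite qE powR_gt0.
have g0 : 0 < (p * h - 1) / p by rewrite divr_gt0// subr_gt0.
have q1 : q < 1 by rewrite qE powR2N_lt1.
have q1' : 0 < 1 - q by rewrite subr_gt0.
pose D := N%:R * A * delta `^ (p * h) * L `^ (1 - p) * (1 - q) `^ (1 - p).
have D0 : 0 <= D by rewrite /D !mulr_ge0 ?powR_ge0.
have term k : step_error p h A N delta (fun k => L * (1 - q) * q ^+ k) k <= D * q ^+ k.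
  have two k' : 2 ^+ k' = 2 `^ k'%:R :> R by rewrite powR_mulrn.
  have qk : q ^+ k = 2 `^ (- ((p * h - 1) / p) * k%:R).
    by rewrite powRrM -qE -powR_mulrn// ltW.
  rewrite /step_error natrM natrX.
  rewrite !powRM ?mulr_ge0 ?invr_ge0 ?exprn_ge0 ?(ltW q0) ?(ltW L0) ?(ltW q1') ?(ltW d0)//.
  rewrite [X in _ <= D * X]qk.
  have half : ((2 ^+ k.+1)^-1) `^ (p * h) <= 2 `^ (- (p * h) * k%:R) :> R.
    rewrite two -powRN -powRrM; apply: ler_powR; first by rewrite ler1n.
    rewrite -natr1 -subr_ge0; set z := k%:R.
    rewrite (_ : _ - _ = p * h); last ring.
    by rewrite (le_trans ler01)// ltW.
  apply: (@le_trans _ _ (N%:R * 2 ^+ k * (L `^ (1 - p) * (1 - q) `^ (1 - p) *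
     (q ^+ k) `^ (1 - p) * (A * (delta `^ (p * h) * 2 `^ (- (p * h) * k%:R)))))).
    by rewrite !ler_wpM2l// ?mulr_ge0 ?powR_ge0 ?exprn_ge0.
  rewrite qk -powRrM two.
  rewrite [leLHS](_ : _ = D * (2 `^ k%:R * 2 `^ (- ((p * h - 1) / p) * k%:R * (1 - p)) *
      2 `^ (- (p * h) * k%:R))); last by rewrite /D; ring.
  rewrite -!powRD ?pnatr_eq0 ?implybT//.
  rewrite (_ : k%:R + _ + _ = - ((p * h - 1) / p) * k%:R)//.
  by field; rewrite gt_eqF.
apply: (@le_trans _ _ (D * \sum_(k < n) q ^+ k)).
  by rewrite mulr_sumr; apply: ler_sum => k _; exact: term.
have -> : (1 - q) `^ (- p) = (1 - q) `^ (1 - p) * (1 - q)^-1.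
  rewrite -[(1 - q)^-1]powR_inv1 ?ltW// -powRD ?(gt_eqF q1') ?implybT//.
  by congr (_ `^ _); ring.
rewrite mulrA -/D ler_wpM2l// -[leRHS]mul1r ler_pdivlMr// mulrC.
by apply: geometric_sum_le; rewrite q0.
Qed.

(** Half of the exponent is kept for the level m, the other half is spent on
    making the sum over j converge.  This uses that (m + j)^alpha dominates both
    m^alpha and (j + 1)^alpha, hence their average. *)
Lemma exp_marginal_tail_sum (C1 C2 alpha : R) : 0 < C1 -> 0 < C2 -> 0 < alpha ->
  exists2 K : R, 0 <= K &
  forall (disp : measure_display) (Omega : measurableType disp)
    (P : probability Omega R) (T : R) (d : nat) (X : R -> Omega -> 'rV[R]_d),
  exp_marginal_decay P T X alpha C1 C2 ->
  forall m t n, 1 <= m -> 0 <= t <= T ->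
  (\sum_(j < n) P [set w | (m + j%:R <= enorm (X t w))%R]
    <= (K * expR (- (C1 / 2 * m `^ alpha)))%:E)%E.
Proof.
move=> C10 C20 a0.
have [||M M0 decay] := @expR_powR_decay (C1 / 2) alpha 2%:R _ a0 _ => //.
  by rewrite divr_gt0.
exists (C2 * M * 2); first by rewrite !mulr_ge0// ltW.
move=> disp Omega P T d X dX m t n m1 tT.
have term (j : nat) : (P [set w | (m + j%:R <= enorm (X t w))%R] <=
    (C2 * expR (- (C1 / 2 * m `^ alpha)) * (M * j.+1%:R `^ (- 2%:R)))%:E)%E.
  have mj0 : 0 < m + j%:R by rewrite (lt_le_trans (lt_le_trans ltr01 m1))// lerDl.
  rewrite (le_trans (dX t (m + j%:R) tT mj0))// lee_fin -mulrA ler_pM2l//.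
  rewrite (le_trans _ (ler_wpM2l (expR_ge0 _) (decay _ _)))// -expRD ler_expR.
  rewrite -opprD lerN2.
  have h1 : m `^ alpha <= (m + j%:R) `^ alpha.
    by apply: ge0_ler_powR; rewrite ?nnegrE ?lerDl ?(ltW a0) ?(ltW mj0)// (le_trans ler01).
  have h2 : j.+1%:R `^ alpha <= (m + j%:R) `^ alpha.
    apply: ge0_ler_powR; rewrite ?nnegrE ?(ltW a0) ?(ltW mj0)//.
    by rewrite -natr1 addrC lerD2r.
  by nra.
apply: (@le_trans _ _ (\sum_(j < n)
    (C2 * expR (- (C1 / 2 * m `^ alpha)) * (M * j.+1%:R `^ (- 2%:R)))%:E)%E).
  by apply: lee_sum => j _; exact: term.
rewrite sumEFin lee_fin -mulr_sumr -mulr_sumr.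
have := ler_wpM2l M0 (sum_inv_sqr_le n).
have := expR_ge0 (- (C1 / 2 * m `^ alpha)); set x := expR _ => x0 h.
rewrite [leRHS](_ : _ = C2 * x * (M * 2)); last ring.
by apply: ler_wpM2l => //; rewrite mulr_ge0// ltW.
Qed.

End estimates.

(** * The tail of the supremum *)

Theorem theorem2p4 (R : realType) (p h alpha C1 C2 A : R)
  (hp : 1 < p) (h_gt0 : 0 < h) (h_le1 : h <= 1) (hph : 1 < p * h)
  (halpha : 0 < alpha) (hC1 : 0 < C1) (hC2 : 0 < C2) (hA : 0 <= A) :
  exists C : R,
  forall (disp : measure_display) (Omega : measurableType disp)
    (P : probability Omega R) (F : R -> set (set Omega))
    (T : R) (d : nat) (X : R -> Omega -> 'rV[R]_d),
    filtration F ->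
    usual_conditions P F ->
    0 < T ->
    continuous_process P T X ->
    adapted F T X ->
    conditional_increment_control P F T X p h A ->
    exp_marginal_decay P T X alpha C1 C2 ->
    exists lambda0 : R, 0 < lambda0 /\
      forall lambda : R, lambda0 <= lambda ->
        (P [set w | (lambda%:E <= sup_enorm T X w)%E]
         <= (C * lambda `^ (- h^-1) *
             expR (- (C1 / 2 `^ (alpha + 2) * (1 - (p * h)^-1)
                      * lambda `^ alpha)))%:E)%E.
Proof.
exists 1 => disp Omega P F T d X filtF [cP _] T0 cX adX incX dX.
have [K0 K00 tail] := exp_marginal_tail_sum hC1 hC2 halpha.
set a := C1 / 2 `^ (alpha + 2); set ph := p * h; set r := ph^-1.
have a0 : 0 < a by rewrite divr_gt0// powR_gt0.
have r0 : 0 < r by rewrite invr_gt0 (lt_trans ltr01).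
have r1 : 0 < 1 - r by rewrite subr_gt0 invf_lt1// (lt_trans ltr01).
have ph1 : 0 < ph - 1 by rewrite subr_gt0.
have hV0 : 0 < h^-1 by rewrite invr_gt0.
have [M1 M10 decay1] := expR_powR_decay (mulr_gt0 a0 r0) halpha hV0.
have [M2 M20 decay2] :=
  expR_powR_decay (mulr_gt0 (mulr_gt0 a0 ph1) r1) halpha hV0.
pose q : R := 2 `^ (- ((p * h - 1) / p)).
pose D := A * T `^ ph * (1 - q) `^ (- p).
have D0 : 0 <= D by rewrite !mulr_ge0// powR_ge0.
pose c := 3 * K0 * M1 + D * M2.
have c0 : 0 <= c.
  by rewrite /c; apply: addr_ge0; [rewrite mulr_ge0 ?mulr_ge0|rewrite mulr_ge0].
exists (8 + 8 * c); split; first by rewrite ltr_wpDr// mulr_ge0.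
move=> lambda lam_ge; rewrite mul1r.
have lam8 : 8 <= lambda by rewrite (le_trans _ lam_ge)// lerDl mulr_ge0.
have lam0 : 0 < lambda by rewrite (lt_le_trans _ lam8).
pose L := lambda / 8; have L1 : 1 <= L by rewrite /L; lra.
have L0 : 0 < L by rewrite (lt_le_trans ltr01).
have cL : c <= L by rewrite /L; lra.
set x := lambda `^ alpha.
(* Of size exp(a x), so that both N exp(- 2 a x) and N^(1 - ph) beat
   exp(- a (1 - r) x). *)
pose N := (Num.truncn (expR (a * x))).+1.
have N_ge : expR (a * x) <= N%:R by rewrite ltW// truncnS_gt.
have N_le : N.+1%:R <= 3 * expR (a * x).
  have E1 : 1 <= expR (a * x).
    by rewrite -expR0 ler_expR mulr_ge0 ?powR_ge0// ltW.
  have := truncn_le (expR (a * x)); rewrite expR_ge0 -!natr1; lra.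
have N0 : 0 < N%:R :> R by [].
pose delta := T / N%:R.
have delta0 : 0 < delta by rewrite divr_gt0.
have T_E : T = N%:R * delta by rewrite /delta mulrC divfK// gt_eqF.
(* The level 3 lambda / 4 of the grid hits pays for m = lambda / 2 and for the
   thresholds, of total size at most L, and still leaves L to divide by. *)
pose m := lambda / 2.
pose K := K0 * expR (- (C1 / 2 * m `^ alpha)).
have m0 : 0 <= m by rewrite divr_ge0// ltW.
have tailX t : 0 <= t <= T -> forall n,
    (\sum_(j < n) P [set w | (m + j%:R <= enorm (X t w))%R] <= K%:E)%E.
  by move=> tT n; apply: (tail _ _ _ _ _ _ dX) => //; rewrite /m; lra.
have q0 : 0 < q by rewrite powR_gt0.
have q1 : q < 1 by rewrite powR2N_lt1// divr_gt0// (lt_trans ltr01).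
pose e k := L * (1 - q) * q ^+ k.
have e0 k : 0 < e k by rewrite !mulr_gt0 ?exprn_gt0// subr_gt0.
have ell0 : 0 < lambda * (3 / 4) by rewrite mulr_gt0.
apply: (sup_event_le filtF adX delta0 T_E cP cX (ell := lambda * (3 / 4))) => [|n].
  by lra.
have grid := grid_maximal filtF adX incX hp m0 tailX delta0 T_E e0 n ell0.
have e_sum : \sum_(k < n) e k <= L.
  rewrite -mulr_sumr -mulrA ler_piMr ?(ltW L0)//.
  by apply: geometric_sum_le; rewrite q0.
have S_le := step_error_geometric N n hp hph hA delta0 L0 (erefl q).
rewrite -/e in S_le.
set S := \sum_(k < n) step_error _ _ _ _ _ _ k in grid S_le *.
set pr := fine _ in grid *.
have pr0 : 0 <= pr by rewrite fine_ge0.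
have KE : K = K0 * (expR (- (a * x)) * expR (- (a * x))).
  rewrite -expRD /K; congr (_ * expR _).
  rewrite /m powRM ?invr_ge0 ?(ltW lam0)// -/x -[2^-1 in X in _ * X]powR_inv1//.
  rewrite -powRrM mulN1r powRN /a powRD ?pnatr_eq0 ?implybT// [2 `^ 2]powR_mulrn//.
  by field; rewrite gt_eqF ?powR_gt0.
set b := expR (- (a * (1 - r) * x)); have b0 : 0 <= b by exact: expR_ge0.
have first_le : N.+1%:R * K <= 3 * K0 * M1 * (lambda `^ (- h^-1) * b).
  rewrite (le_trans (ler_wpM2r _ N_le))//.
    by rewrite KE !mulr_ge0// expR_ge0.
  rewrite KE [leLHS](_ : _ = 3 * K0 * expR (- (a * x)) *
    (expR (a * x) * expR (- (a * x)))); last ring.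
  rewrite expRxMexpNx_1 mulr1.
  have -> : expR (- (a * x)) = b * expR (- (a * r * x)).
    by rewrite -expRD; congr expR; ring.
  have := ler_wpM2l (mulr_ge0 (mulr_ge0 (ler0n R 3) K00) b0) (decay1 _ lam0).
  by rewrite -/x => H; lra.
have second_le : S <= D * M2 * (lambda `^ (- h^-1) * b).
  rewrite (le_trans S_le)// -/ph.
  have L_le : L `^ (1 - p) <= 1.
    by rewrite -[leRHS](powRr0 L) ler_powR// subr_le0 ltW.
  have N_delta : N%:R * delta `^ ph <= T `^ ph * expR (- (a * x * (ph - 1))).
    rewrite /delta powRM ?invr_ge0 ?(ltW T0)// mulrCA ler_wpM2l ?powR_ge0//.
    have -> : N%:R * N%:R^-1 `^ ph = (N%:R `^ (ph - 1))^-1 :> R.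
      rewrite -[in N%:R^-1]powR_inv1// -powRrM mulN1r -powRN opprB.
      by rewrite powRD ?(gt_eqF N0) ?implybT// powRr1.
    rewrite expRN lef_pV2 ?posrE ?expR_gt0 ?powR_gt0// expRM.
    by apply: ge0_ler_powR; rewrite ?nnegrE ?expR_ge0 ?(ltW ph1).
  have EE : expR (- (a * x * (ph - 1))) = b * expR (- (a * (ph - 1) * (1 - r) * x)).
    rewrite -expRD; congr expR; rewrite /r; field.
    by rewrite gt_eqF// (lt_trans ltr01).
  have Aq0 : 0 <= A * (1 - q) `^ (- p) by rewrite mulr_ge0// powR_ge0.
  have Nd0 : 0 <= N%:R * delta `^ ph by rewrite mulr_ge0// powR_ge0.
  rewrite [leLHS](_ : _ = A * (1 - q) `^ (- p) * (N%:R * delta `^ ph * L `^ (1 - p))).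
    rewrite [leRHS](_ : _ = A * (1 - q) `^ (- p) *
      (T `^ ph * (b * (M2 * lambda `^ (- h^-1))))); last by rewrite /D; ring.
    apply: ler_wpM2l => //; rewrite (le_trans (ler_piMr Nd0 L_le))//.
    rewrite (le_trans N_delta)// EE !ler_wpM2l// ?powR_ge0//.
    exact: decay2.
  by ring.
have := ler_wpM2r (mulr_ge0 (powR_ge0 lambda (- h^-1)) b0) cL.
rewrite /c; set z := lambda `^ _ * b => cz.
rewrite -(ler_pM2l L0).
have : L * pr <= (lambda * (3 / 4) - m - \sum_(k < n) e k) * pr.
  apply: ler_wpM2r => //; rewrite lerBrDl -lerBrDr (le_trans e_sum)// /m /L; lra.
move=> /le_trans/(_ grid)/le_trans; apply.
by rewrite (le_trans _ cz)// [leRHS]mulrDl lerD.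
Qed.
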